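(* Let $k\ge 1$ be an integer. The oddness of the graph $T^{2}_{\alpha}(2k+1;1,1,1)$ is $k+2$ when $k$ is even and $k+1$ when $k$ is odd.
   Context: Let $P$ be the Petersen graph, let $o$ be a vertex of $P$ with neighbours $n_1,n_2,n_3$. Let $\bar T$ be the cubic graph obtained from $P$ by deleting $o$ and adding a triangle $p_1p_2p_3$ with $p_i$ adjacent to $n_i$ ($i=1,2,3$). Let $T^2$ be the graph $\bar T-\{p_1,p_2,n_2\}$ (i.e., the path $p_1p_2n_2$ is deleted). Put $v:=p_3$ (the neighbour of $p_2$ other than $p_1,n_2$). Label the two neighbours $p_3,n_1$ of $p_1$ other than $p_2$ as $A,B$ (in some order), and the two neighbours of $n_2$ other than $p_2$ as $A',B'$ (in some order); the claim is asserted for every such labeling. For $m\ge 3$, $T^2_{\alpha}(m;1,1,1)$ is the graph with vertex set $\{u_i:u\in V(T^2),\ i\in\mathbb{Z}_m\}\cup\{w_i:i\in\mathbb{Z}_m\}$ and edges $u_iu'_i$ for each edge $uu'$ of $T^2$, spoke edges $v_iw_i$, loop edges $w_iw_{i+1}$, and connecting edges $A'_iA_{i+1}$, $B'_iB_{i+1}$ (indices mod $m$). It is a cubic graph on $10m$ vertices. A 2-factor of a graph is a spanning 2-regular subgraph (a disjoint union of cycles covering all vertices); the oddness of a cubic graph is the minimum number of odd-length cycles in a 2-factor. *)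

(* Defs.v *)
From HB Require Import structures.
From mathcomp Require Import all_boot.

Set Implicit Arguments.
Unset Strict Implicit.
Unset Printing Implicit Defensive.

(* Graphs are symmetric irreflexive relations on a finType. *)

(* A 2-factor is identified with its adjacency relation [f] on the whole
   vertex set. *)
Definition two_factor (V : finType) (e f : rel V) : Prop :=
  [/\ symmetric f, subrel f e & forall x, #|f x| = 2].

Definition components (V : finType) (f : rel V) : {set {set V}} :=
  [set [set y | connect f x y] | x : V].

(* The cycles of a 2-factor are its connected components, and the length of a
   cycle is its number of vertices. *)
Definition odd_cycles (V : finType) (f : rel V) : nat :=
  #|[set C in components f | odd #|C|]|.

(* [is_oddness e d]: the minimum over all 2-factors of [e] exists and is [d]. *)
Definition is_oddness (V : finType) (e : rel V) (d : nat) : Prop :=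
  (exists2 f : rel V, two_factor e f & odd_cycles f = d) /\
  (forall f : rel V, two_factor e f -> d <= odd_cycles f).

(* The Petersen graph as the Kneser graph K(5,2). *)
Definition petersen : finType := {S : {set 'I_5} | #|S| == 2}.

Definition petersen_adj : rel petersen :=
  fun S U => [disjoint sval S & sval U].

(* The indices 1, 2, 3 of the p_i and n_i. *)
Definition i1 : 'I_3 := @Ordinal 3 0 isT.
Definition i2 : 'I_3 := @Ordinal 3 1 isT.
Definition i3 : 'I_3 := @Ordinal 3 2 isT.

Definition petersen_minus (o : petersen) : finType := {x : petersen | x != o}.

(* The vertices of T-bar: [inl x] is a vertex of P - o, [inr i] is p_i. *)
Definition tbar_vertex (o : petersen) : finType :=
  (petersen_minus o + 'I_3)%type.

Definition tbar_adj (o : petersen) (n : 'I_3 -> petersen_minus o) :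
    rel (tbar_vertex o) := fun x y =>
  match x, y with
  | inl a, inl b => petersen_adj (sval a) (sval b)
  | inr i, inr j => i != j
  | inl a, inr i | inr i, inl a => a == n i
  end.

Definition tbar_p (o : petersen) (i : 'I_3) : tbar_vertex o := inr i.
Definition tbar_n (o : petersen) (n : 'I_3 -> petersen_minus o) (i : 'I_3) :
  tbar_vertex o := inl (n i).

Definition t2_vertex (o : petersen) (n : 'I_3 -> petersen_minus o) : finType :=
  {x : tbar_vertex o |
    x \notin [:: tbar_p o i1; tbar_p o i2; tbar_n n i2]}.

Definition t2_adj (o : petersen) (n : 'I_3 -> petersen_minus o) :
  rel (t2_vertex n) := fun x y => tbar_adj n (sval x) (sval y).

(* [inl (u, i)] is u_i and [inr i] is w_i. *)
Definition t2alpha_vertex (o : petersen) (n : 'I_3 -> petersen_minus o)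
  (m : nat) : finType := (t2_vertex n * 'I_m + 'I_m)%type.

(* Each edge, listed in at least one of its two directions; [ordS] is the
   successor modulo [m]. *)
Definition t2alpha_arc (o : petersen) (n : 'I_3 -> petersen_minus o)
    (A B A' B' : t2_vertex n) (m : nat) : rel (t2alpha_vertex n m) :=
  fun x y =>
  match x, y with
  | inl (u, i), inl (u', j) =>
      (i == j) && t2_adj u u' ||
      (j == ordS i) && ((u == A') && (u' == A) || (u == B') && (u' == B))
  | inl (u, i), inr j => (sval u == tbar_p o i3) && (i == j)
  | inr i, inr j => j == ordS i
  | inr _, inl _ => false
  end.

Definition t2alpha_adj (o : petersen) (n : 'I_3 -> petersen_minus o)
    (A B A' B' : t2_vertex n) (m : nat) : rel (t2alpha_vertex n m) :=
  fun x y => t2alpha_arc A B A' B' x y || t2alpha_arc A B A' B' y x.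

(* Main.v *)
Require Import Defs.
From mathcomp Require Import all_boot zify.

Set Implicit Arguments.
Unset Strict Implicit.
Unset Printing Implicit Defensive.

(* The graph is a ring of m = 2k + 1 copies of a 10-vertex block. Every 2-factor
   contains an odd cycle inside any two consecutive blocks: this is a finite check
   on the 33 edges that meet such a window. A cycle lies in at most two windows,
   so there are at least m / 2, hence at least k + 1, odd cycles, and their number
   is even because the graph has 10m vertices. Conversely, an explicit periodic
   2-factor has at most k + 2 cycles, and parity removes one of them when k is
   odd. All labelings give isomorphic graphs: exchanging both pairs (A, B) and
   (A', B') changes nothing, and an automorphism of the Petersen graph fixing o and
   the n_i exchanges A' and B'. *)

(** * Cycles of 2-factors *)

Lemma partition_components (V : finType) (f : rel V) :
  symmetric f -> partition (components f) [set: V].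
Proof.
move=> f_sym; have f_csym := sym_connect_sym f_sym.
have eqf : {in [set: V] & &, equivalence_rel (connect f)}.
  move=> x y z _ _ _; split=> [|xy]; first exact: connect0.
  exact: same_connect.
have -> : components f = equivalence_partition (connect f) [set: V].
  rewrite /components /equivalence_partition; apply/setP=> C.
  by apply/imsetP/imsetP=> -[x _ ->]; exists x => //; apply/setP=> y;
    rewrite !inE.
exact: equivalence_partitionP.
Qed.

(** Modulo 2, only the components of odd size contribute to the sum of all component sizes. *)
Lemma odd_odd_cycles (V : finType) (f : rel V) :
  symmetric f -> odd (odd_cycles f) = odd #|V|.
Proof.
move=> f_sym; rewrite -cardsT (card_partition (partition_components f_sym)).
rewrite /odd_cycles -sum1_card !(big_morph odd oddD (erefl _)).
rewrite [RHS]big_mkcond [LHS]big_mkcond /=; apply: eq_bigr => C _.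
by rewrite !inE; case: (C \in components f); case: (odd #|C|).
Qed.

(** A vertex of [c] already has two distinct neighbours along [c], because [2 < size c]; degree 2
    then leaves no edge of [f] from [c] to the outside. *)
Lemma cycle_component (V : finType) (e f : rel V) (c : seq V) (x : V) :
    two_factor e f -> cycle f c -> uniq c -> 2 < size c -> x \in c ->
  [set y | connect f x y] = [set y in c].
Proof.
move=> [f_sym _ f_deg] f_c c_uniq c_size xc.
have clo : closed f c.
  apply: intro_closed; first exact: sym_connect_sym.
  move=> y z fyz yc; have [i p def_c] := rot_to yc.
  have : cycle f (rot i c) by rewrite rot_cycle.
  have : uniq (rot i c) by rewrite rot_uniq.
  have : 2 < size (rot i c) by rewrite size_rot.
  rewrite -(mem_rot i) def_c; case: p {def_c} => [|a p] //=.
  case/lastP: p => [|p b] //= _ /and3P[yap ap _].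
  rewrite rcons_path last_rcons => /and3P[fya _ fby].
  (* Here [a] and [b] follow and precede [y] on the cycle; a [z] off the cycle would be a third
     neighbour. *)
  apply/negP/negP; rewrite !inE !mem_rcons !inE.
  apply/negP=> /negP; rewrite !negb_or => /and4P[zy za zb _].
  have ab : a != b by apply: contraNneq ap => ->; rewrite mem_rcons mem_head.
  have /card_uniqP s3 : uniq [:: z; a; b] by rewrite /= !inE negb_or za zb ab.
  suff : #|[:: z; a; b]| <= #|f y| by rewrite s3 f_deg.
  apply/subset_leq_card/subsetP=> t; rewrite !inE => /or3P[] /eqP->;
    by rewrite ?fyz // /in_mem /= ?fya // f_sym fby.
apply/setP=> y; rewrite !inE; apply/idP/idP=> [xy|yc].
  by rewrite -(closed_connect clo xy).
have [i p def_c] := rot_to xc.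
have : cycle f (rot i c) by rewrite rot_cycle.
move: yc; rewrite -(mem_rot i) def_c /= inE => /predU1P[->//|yp].
rewrite rcons_path => /andP[fp _].
exact: (path_connect fp (mem_behead (s := x :: p) yp)).
Qed.

Lemma connect_relpre (V W : finType) (h : V -> W) (f : rel W) (x y : V) :
  bijective h -> connect (relpre h f) x y = connect f (h x) (h y).
Proof.
case=> g hK gK; apply/connectP/connectP=> [[p fp ->]|[p fp hy]].
  exists (map h p); last by rewrite last_map.
  by rewrite path_map.
exists (map g p); last by rewrite -(hK x) last_map -hy hK.
by rewrite -path_map -map_comp (eq_map gK) map_id.
Qed.

Lemma odd_cycles_relpre (V W : finType) (h : V -> W) (f : rel W) :
  bijective h -> odd_cycles (relpre h f) = odd_cycles f.
Proof.
move=> h_bij; have h_inj := bij_inj h_bij.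
rewrite /odd_cycles -(card_imset _ (imset_inj h_inj)); congr #|pred_of_set _|.
have hcomp x : h @: [set y | connect (relpre h f) x y] =
    [set y | connect f (h x) y].
  apply/setP=> y; rewrite inE; apply/imsetP/idP=> [[z]|].
    by rewrite inE connect_relpre // => fz ->.
  have [g hK gK] := h_bij => fy.
  by exists (g y); rewrite ?gK // inE connect_relpre ?gK.
apply/setP=> C; apply/imsetP/setIdP=> [[D]|[/imsetP[x _ ->] oC]].
  rewrite inE => /andP[/imsetP[x _ ->] oC] ->; split.
    by rewrite hcomp; apply/imsetP; exists (h x).
  by rewrite card_imset.
have [g hK gK] := h_bij.
exists [set y | connect (relpre h f) (g x) y]; last by rewrite hcomp gK.
rewrite inE -(card_imset _ h_inj) hcomp gK oC andbT.
by apply/imsetP; exists (g x).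
Qed.

Lemma two_factor_relpre (V W : finType) (h : V -> W) (e f : rel W) :
  bijective h -> two_factor e f -> two_factor (relpre h e) (relpre h f).
Proof.
move=> h_bij [f_sym fe f_deg]; split=> [x y|x y|x] /=.
- exact: f_sym.
- exact: fe.
have [g hK gK] := h_bij; rewrite -(f_deg (h x)) -(card_image (can_inj gK)).
apply: eq_card => y; rewrite /in_mem /=; apply/idP/imageP=> [fy|[z fz ->]].
  by exists (h y); rewrite ?hK.
by rewrite gK.
Qed.

Lemma is_oddness_iso (V W : finType) (h : V -> W) (e : rel V) (e' : rel W) d :
    bijective h -> (forall x y, e' (h x) (h y) = e x y) ->
  is_oddness e d -> is_oddness e' d.
Proof.
move=> h_bij ee' [[f f_e fd] dmin]; have [g hK gK] := h_bij.
have g_bij : bijective g by exists h.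
split.
  exists (relpre g f); last by rewrite odd_cycles_relpre.
  have [sf sub_fe df] := two_factor_relpre g_bij f_e; split=> // x y fxy.
  by rewrite -(gK x) -(gK y) ee'; apply: sub_fe.
move=> f' f'_e'; rewrite -(odd_cycles_relpre f' h_bij); apply: dmin.
have [sf sub_fe df] := two_factor_relpre h_bij f'_e'; split=> // x y fxy.
by rewrite -ee'; apply: sub_fe.
Qed.

(** The bound holds even for the number of all components, since each contains a member of
    [reps]. *)
Lemma odd_cycles_le (V : finType) (f : rel V) (reps : seq V) :
    symmetric f -> (forall x, exists2 y, y \in reps & connect f x y) ->
  odd_cycles f <= size reps.
Proof.
move=> f_sym cover; pose C (x : V) := [set y | connect f x y].
apply: (@leq_trans #|C @: [set x in reps]|).
  apply/subset_leq_card/subsetP=> D /setIdP[/imsetP[x _ ->] _].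
  have [y yr xy] := cover x; apply/imsetP; exists y; rewrite ?inE //.
  by apply/setP=> z; rewrite !inE (same_connect (sym_connect_sym f_sym) xy).
by rewrite (leq_trans (leq_imset_card _ _)) // cardsE card_size.
Qed.

(** * A concrete model of the graph *)

(* The vertices of a block are numbered as follows: with [o = {a, b}] and
   [c_i] the element of 'I_5 outside [o] and [n_i], let [x_i = {a, c_i}] and
   [y_i = {b, c_i}]; then w, p_3, n_3, n_1, x_1, y_1, x_2, y_2, x_3, y_3 are
   0, ..., 9. *)
Definition inner_edges : seq (nat * nat) :=
  [:: (4, 7); (4, 9); (6, 5); (6, 9); (8, 5); (8, 7);
      (3, 4); (3, 5); (2, 8); (2, 9); (2, 1); (1, 0)].

Definition inner (u v : nat) : bool :=
  ((u, v) \in inner_edges) || ((v, u) \in inner_edges).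

Definition outer_edges : seq (nat * nat) := [:: (6, 1); (7, 3); (0, 0)].

Definition outer (u v : nat) : bool := (u, v) \in outer_edges.

Definition model (m : nat) : finType := ('I_10 * 'I_m)%type.

(** Edges inside a layer come from [r], arcs to the next layer from [s]. Both may depend on the
    layer, so that one definition serves the model graph and the periodic 2-factor. *)
Definition layered_rel (m : nat) (r s : 'I_m -> rel nat) : rel (model m) :=
  fun x y =>
  [|| (x.2 == y.2) && r x.2 x.1 y.1,
      (y.2 == ordS x.2) && s x.2 x.1 y.1 |
      (x.2 == ordS y.2) && s y.2 y.1 x.1].

Definition model_adj (m : nat) : rel (model m) :=
  layered_rel (fun=> inner) (fun=> outer).

Definition mvert (m : nat) (i : 'I_m) (u : nat) : model m := (inord u, i).

Definition inner_nbs (u : nat) := [seq v <- iota 0 10 | inner u v].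
Definition next_nbs (u : nat) := [seq v <- iota 0 10 | outer u v].
Definition prev_nbs (u : nat) := [seq v <- iota 0 10 | outer v u].

Lemma mvertK (m : nat) (x : model m) : mvert x.2 x.1 = x.
Proof. by case: x => u i; rewrite /mvert inord_val. Qed.

Lemma mvert_inj (m : nat) (i : 'I_m) : {in iota 0 10 &, injective (mvert i)}.
Proof.
move=> u v; rewrite !mem_iota /= add0n => u10 v10 [] /(congr1 val).
by rewrite /= !inordK.
Qed.

Lemma ordS_neq (m : nat) (i : 'I_m) : 1 < m -> ordS i != i.
Proof.
move=> m1; apply/eqP=> /(congr1 val) /=; case: i => i /= im.
have [im1|im1] := ltnP i.+1 m; first by rewrite modn_small //; lia.
have -> : i.+1 = m by lia.
by rewrite modnn; lia.
Qed.

Lemma ordSS_neq (m : nat) (i : 'I_m) : 2 < m -> ordS (ordS i) != i.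
Proof.
move=> m2; apply/eqP=> /(congr1 val) /=; have := ltn_ord i.
rewrite -(addn1 (_ %% _)) modnDml addn1 => im.
have [im2|im2] := ltnP i.+2 m; first by rewrite modn_small //; lia.
have -> : i.+2 = (i.+2 - m) + m by lia.
by rewrite modnDr modn_small; lia.
Qed.

(** For [2 < m] the blocks [i], [ordS i] and [ord_pred i] are distinct, so the three lists of
    possible neighbours are disjoint and the degree splits into three counts. *)
Lemma card_model_nbs (m : nat) (f : rel (model m)) (i : 'I_m) (u : nat) :
    2 < m -> u < 10 -> subrel f (@model_adj m) ->
  #|f (mvert i u)| =
    count (fun v => f (mvert i u) (mvert i v)) (inner_nbs u) +
    count (fun v => f (mvert i u) (mvert (ordS i) v)) (next_nbs u) +
    count (fun v => f (mvert i u) (mvert (ord_pred i) v)) (prev_nbs u).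
Proof.
move=> m2 u10 fe.
set s := map (mvert i) (inner_nbs u) ++ map (mvert (ordS i)) (next_nbs u) ++
  map (mvert (ord_pred i)) (prev_nbs u).
have -> : #|f (mvert i u)| = count (f (mvert i u)) s.
  have s_uniq : uniq s.
    have sub j (p : pred nat) : uniq (map (mvert j) [seq v <- iota 0 10 | p v]).
      rewrite map_inj_in_uniq ?filter_uniq ?iota_uniq // => v w.
      by rewrite !mem_filter => /andP[_ ?] /andP[_ ?]; apply: mvert_inj.
    rewrite !cat_uniq !sub /= andbT; apply/andP; split.
      apply/hasPn=> x; rewrite mem_cat => /orP[] /mapP[v _ ->];
        apply/mapP=> -[w _ [_ /esym/eqP]].
        by apply/negP; rewrite eq_sym ordS_neq //; lia.
      by apply/negP; rewrite -{1}(ord_predK i) ordS_neq //; lia.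
    apply/hasPn=> x /mapP[v _ ->]; apply/mapP=> -[w _ [_ /esym/eqP]].
    by apply/negP; rewrite -{1}(ord_predK i) ordSS_neq.
  rewrite -size_filter -(card_uniqP (filter_uniq _ s_uniq)).
  apply: eq_card => x; rewrite mem_filter -[LHS]/(f (mvert i u) x).
  case fx : (f _ x) => //=; apply/esym; move/fe: fx.
  rewrite -(mvertK x) /model_adj /layered_rel /= inordK // inord_val mem_cat.
  have x10 : nat_of_ord x.1 \in iota 0 10 by rewrite mem_iota /= add0n.
  case/or3P=> /andP[/eqP xi xu].
  - by rewrite -xi map_f // mem_filter xu.
  - by rewrite xi mem_cat map_f ?orbT // mem_filter xu.
  - by rewrite xi ordSK mem_cat map_f ?orbT // mem_filter xu.
by rewrite /s !count_cat !count_map addnA.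
Qed.

(** * Every two consecutive blocks contain an odd cycle *)

(* The conditional matters: [||] would evaluate both of its sides. *)
Fixpoint search (prune goal : pred (seq bool)) (n : nat) (s : seq bool) : bool :=
  if prune s then true else
  if n is n'.+1 then
    search prune goal n' (rcons s true) && search prune goal n' (rcons s false)
  else goal s.

(** Follow the branch described by [t] until it is pruned or reaches its leaf. *)
Lemma searchP (prune goal : pred (seq bool)) (n : nat) (s t : seq bool) :
    search prune goal n s -> size t = n ->
  goal (s ++ t) \/ exists k, prune (take k (s ++ t)).
Proof.
elim: n s t => [|n IHn] s t /=; case: ifP => [ps _ _|_].
- by right; exists (size s); rewrite take_size_cat.
- by move=> gs /size0nil->; left; rewrite cats0.
- by right; exists (size s); rewrite take_size_cat.
case/andP=> st sf; case: t => //= b t [szt].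
by rewrite -cat_rcons; apply: IHn => //; case: b.
Qed.

(* The pair [(b, u)] is the vertex [u] of block [b]; the window consists of the
   blocks 1 and 2. *)
Definition window_edges : seq (nat * nat * (nat * nat)) :=
  let outers b := [seq ((b, e.1), (b.+1, e.2)) | e <- outer_edges] in
  let inners b := [seq ((b, e.1), (b, e.2)) | e <- inner_edges] in
  outers 0 ++ inners 1 ++ outers 1 ++ inners 2 ++ outers 2.

(** Each edge is listed in one direction only, and [index] returns the length of the list for an
    absent pair, so the minimum selects the listed direction. *)
Definition edge_index (x y : nat * nat) : nat :=
  minn (index (x, y) window_edges) (index (y, x) window_edges).

Definition window : seq (nat * nat) :=
  [seq (b, u) | b <- [:: 1; 2], u <- iota 0 10].

Definition window_nbs (x : nat * nat) : seq (nat * nat) :=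
  [seq (x.1, v) | v <- inner_nbs x.2] ++
  [seq (x.1.+1, v) | v <- next_nbs x.2] ++
  [seq (x.1.-1, v) | v <- prev_nbs x.2].

(** Evaluated once, so that the search does not recompute the table at every node. *)
Definition incidences : seq (seq nat) := Eval vm_compute in
  [seq [seq edge_index x y | y <- window_nbs x] | x <- window].

Lemma incidencesE :
  incidences = [seq [seq edge_index x y | y <- window_nbs x] | x <- window].
Proof. by vm_compute. Qed.

(** Only vertices all of whose edges are decided by the prefix are tested, so a failure persists in
    every extension. *)
Definition bad_degree (s : seq bool) : bool :=
  has (fun js => all (fun j => j < size s) js && (count (nth false s) js != 2))
    incidences.

(* Besides four 5-cycles in each block, the cycles that use the two edges
   (other than that of the w's) between the blocks. *)
Definition window_odd_cycles : seq (seq (nat * nat)) :=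
  [seq [seq (b, u) | u <- c] | b <- [:: 1; 2],
     c <- [:: [:: 2; 8; 5; 6; 9]; [:: 2; 8; 7; 4; 9];
              [:: 3; 4; 7; 8; 5]; [:: 3; 4; 9; 6; 5]]] ++
  [seq [seq (1, u) | u <- c] ++ [seq (2, u) | u <- d] |
     c <- [:: [:: 7; 4; 9; 6]; [:: 7; 8; 5; 6];
              [:: 7; 4; 3; 5; 8; 2; 9; 6]; [:: 7; 8; 2; 9; 4; 3; 5; 6]],
     d <- [:: [:: 1; 2; 9; 4; 3]; [:: 1; 2; 8; 5; 3];
              [:: 1; 2; 9; 6; 5; 8; 7; 4; 3]; [:: 1; 2; 8; 7; 4; 9; 6; 5; 3]]].

Definition has_odd_cycle (s : seq bool) : bool :=
  has (cycle (fun x y => nth false s (edge_index x y))) window_odd_cycles.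

(** The finite check: a choice among the 33 edges that gives degree 2 to all 20 vertices of the
    window contains a listed cycle. *)
Lemma window_search : search bad_degree has_odd_cycle (size window_edges) [::].
Proof. by vm_compute. Qed.

Lemma window_odd_cyclesP (c : seq (nat * nat)) : c \in window_odd_cycles ->
  [&& uniq c, 2 < size c, odd (size c) & all (mem window) c].
Proof. by move: c; apply/allP; vm_compute. Qed.

Lemma window_odd_cycle (F : rel (nat * nat)) : symmetric F ->
    {in window, forall x, count (F x) (window_nbs x) = 2} ->
  exists2 c, c \in window_odd_cycles & cycle F c.
Proof.
move=> F_sym F_deg; pose s := [seq F e.1 e.2 | e <- window_edges].
have sz_s : size s = size window_edges by rewrite size_map.
have sF x y : edge_index x y < size s -> nth false s (edge_index x y) = F x y.
  rewrite /s /edge_index size_map /minn; case: ifP => _ ilt;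
    rewrite (nth_map ((0, 0), (0, 0))) // nth_index;
    by rewrite -?index_mem // F_sym.
have [] := searchP window_search sz_s => [/hasP[c cw cs]|[k]].
  exists c => //; apply: sub_cycle cs => x y /= sxy.
  (* The default of [nth] is false, so a true bit forces the index into range. *)
  rewrite -sF //; case: ltnP => // le; by rewrite nth_default in sxy.
(* A pruned prefix would exhibit a window vertex whose decided bits, all read off from [F], do not
   add up to 2. *)
rewrite cat0s /bad_degree incidencesE => /hasP[_ /mapP[x xw ->]].
case/andP=> /allP lt /negP[]; rewrite -(F_deg x xw) count_map.
apply/eqP/eq_in_count=> y /(map_f (edge_index x))/lt /=.
by rewrite size_take_min leq_min => /andP[ik ?]; rewrite nth_take // sF.
Qed.

Definition window_vert (m : nat) (i : 'I_m) (x : nat * nat) : model m :=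
  mvert (iter x.1 (@ordS m) i) x.2.

Lemma mem_window (x : nat * nat) :
  x \in window -> [/\ x.1 = 1 \/ x.1 = 2, 0 < x.1 & x.2 < 10].
Proof.
case/allpairsP=> -[b u] [b12]; rewrite mem_iota add0n => /andP[_ u10] -> /=.
by move: b12; rewrite /= !inE => /orP[] /eqP->; split; auto.
Qed.

(** The restriction to the window matters: for [m = 3] the blocks 0 and 3 have the same image. *)
Lemma window_vert_inj (m : nat) (i : 'I_m) :
  2 < m -> {in window &, injective (window_vert i)}.
Proof.
move=> m2 [b u] [c v] /mem_window[/= b12 _ u10] /mem_window[/= c12 _ v10].
case=> /(congr1 val); rewrite /= !inordK // => -> bc; congr (_, _).
have m1 : 1 < m by lia.
case: b12 bc => ->; case: c12 => -> //= /ordS_inj/eqP.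
  by rewrite eq_sym (negPf (ordS_neq _ _)).
by rewrite (negPf (ordS_neq _ _)).
Qed.

(** The pullback of [f] along [window_vert i] has degree 2 on the window, hence contains a listed
    odd cycle; by [cycle_component] the image of that cycle is a whole component. *)
Lemma odd_component_in_window (m : nat) (f : rel (model m)) (i : 'I_m) :
    2 < m -> two_factor (@model_adj m) f ->
  exists2 C, C \in [set C in components f | odd #|C|] &
    {in C, forall x, (x.2 == ordS i) || (x.2 == ordS (ordS i))}.
Proof.
move=> m2 f_e; have [f_sym fe f_deg] := f_e.
pose F := relpre (window_vert i) f.
have F_sym : symmetric F by move=> x y; apply: f_sym.
have [|c cw Fc] := window_odd_cycle F_sym.
  move=> x /mem_window[_ x1 x10].
  rewrite -(f_deg (window_vert i x)) card_model_nbs //.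
  rewrite /window_nbs !count_cat !count_map -addnA.
  congr (_ + (_ + _)); apply: eq_count => v //=.
  by rewrite /F /window_vert /=; case: (x.1) x1 => //= b _; rewrite ordSK.
have /and4P[c_uniq c_size c_odd /allP c_win] := window_odd_cyclesP cw.
have [x xc] : exists x, x \in c.
  by case: (c) c_size => // x c' _; exists x; apply: mem_head.
pose C := map (window_vert i) c.
have C_uniq : uniq C.
  by rewrite map_inj_in_uniq // => y z /c_win yw /c_win zw; apply: window_vert_inj.
have xC : window_vert i x \in C by rewrite map_f.
have comp : [set y | connect f (window_vert i x) y] = [set y in C].
  apply: (cycle_component f_e) => //; first by rewrite cycle_map.
  by rewrite size_map.
exists [set y in C].
  rewrite inE cardsE (card_uniqP C_uniq) size_map c_odd andbT -comp.
  exact: imset_f.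
move=> y; rewrite inE => /mapP[z zc ->] /=.
by have [[]-> _ _] := mem_window (c_win _ zc); rewrite eqxx ?orbT.
Qed.

(** Each window is sent to an odd component inside it together with one bit; this map is
    injective. *)
Lemma odd_cycles_model_ge (m : nat) (f : rel (model m)) :
  2 < m -> two_factor (@model_adj m) f -> m <= odd_cycles f * 2.
Proof.
move=> m2 f_e; have [f_sym _ _] := f_e.
pose O := [set C in components f | odd #|C|].
have ex i : exists C, (C \in O) &&
    [forall (x | x \in C), (x.2 == ordS i) || (x.2 == ordS (ordS i))].
  have [C CO Ci] := odd_component_in_window i m2 f_e.
  by exists C; rewrite CO; apply/forall_inP.
(* The vertex picked by [r] depends on the component alone, so its block and the bit [first i]
   together determine [i]. *)
pose C i := xchoose (ex i); pose r (D : {set model m}) := [pick x in D].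
pose first i := if r (C i) is Some x then x.2 == ordS i else false.
have g_inj : injective (fun i => (C i, first i)).
  move=> i j [eqC]; rewrite /first -eqC.
  have /andP[_ /forall_inP Ci] := xchooseP (ex i).
  have /andP[_ /forall_inP] := xchooseP (ex j); rewrite -/(C j) -eqC => Cj.
  rewrite /r; case: pickP => [x xC|C0].
    have := Ci x xC; have := Cj x xC.
    case: (x.2 =P ordS i) => [xi|_] /=.
      by move=> _ _ /esym/eqP; rewrite xi => /ordS_inj.
    move=> xj /eqP xi /esym nxj; move: xj.
    by rewrite nxj xi => /eqP/ordS_inj/ordS_inj.
  (* A component of odd size is not empty. *)
  have /andP[] := xchooseP (ex i); rewrite inE -/(C i) => /andP[_].
  by rewrite (eq_card0 C0).
rewrite -{1}(card_ord m) -(cardsT 'I_m) -(card_imset _ g_inj) -card_bool.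
rewrite -(cardsT bool) -cardsX; apply/subset_leq_card/subsetP=> _ /imsetP[i _ ->].
by rewrite !inE /=; have /andP[] := xchooseP (ex i); rewrite inE => ->.
Qed.

(** * A 2-factor with few odd cycles *)

(* The sequence of blocks is 0 1 2 (0 3) ... (0 3): each block 0 contains a
   5-cycle, the blocks 1 and 2 share a 13-cycle, and all remaining vertices lie
   on one cycle, which passes through every [w]. The list [[:: 3; 4; 9; 6; 5; 3]]
   is closed; the other ones are open paths. *)
Definition block_paths (t : nat) : seq (seq nat) :=
  nth [::]
    [:: [:: [:: 0; 1; 2; 8; 7]; [:: 3; 4; 9; 6; 5; 3]];
        [:: [:: 3; 5; 8; 2; 1; 0]; [:: 7; 4; 9; 6]];
        [:: [:: 0]; [:: 3; 5; 6; 9; 4; 7; 8; 2; 1]];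
        [:: [:: 3; 4; 7; 8; 5; 6; 9; 2; 1; 0]]] t.

(** The edges of the factor to the next block. After type 1, the exits (6, 1) and (7, 3) belong to
    the 13-cycle; all other exits lie on the long cycle. *)
Definition block_exits (t : nat) : seq (nat * nat) :=
  nth [::] [:: [:: (7, 3)]; outer_edges; [:: (0, 0)]; [:: (0, 0)]] t.

(** The pairs of types of cyclically consecutive blocks; the ring is closed by (2, 0) when k = 1 and
    by (3, 0) when k > 1. *)
Definition transitions : seq (nat * nat) :=
  [:: (0, 1); (0, 3); (1, 2); (2, 0); (3, 0)].

Definition block_type (i : nat) : nat :=
  if i < 3 then i else if odd i then 0 else 3.

Definition linked (t u v : nat) : bool :=
  has (fun p => ((u, v) \in zip p (behead p)) || ((v, u) \in zip p (behead p)))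
    (block_paths t).

Definition joined (t u v : nat) : bool :=
  has (fun p => (u \in p) && (v \in p)) (block_paths t).

Definition sparse_factor (m : nat) : rel (model m) :=
  layered_rel (fun i => linked (block_type i))
    (fun i u v => (u, v) \in block_exits (block_type i)).

Lemma layered_rel_sym (m : nat) (r s : 'I_m -> rel nat) :
  (forall i, symmetric (r i)) -> symmetric (layered_rel r s).
Proof.
move=> r_sym x y; rewrite /layered_rel eq_sym (orbC (_ && s _ _ _)).
by case: (y.2 =P x.2) => // ->; rewrite r_sym.
Qed.

Lemma layered_rel_sub (m : nat) (r s r' s' : 'I_m -> rel nat) :
    (forall i, subrel (r i) (r' i)) -> (forall i, subrel (s i) (s' i)) ->
  subrel (layered_rel r s) (layered_rel r' s').
Proof.
move=> rr' ss' x y /or3P[] /andP[xy h]; apply/or3P.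
- by apply: Or31; rewrite xy rr'.
- by apply: Or32; rewrite xy ss'.
- by apply: Or33; rewrite xy ss'.
Qed.

Lemma layered_same (m : nat) (r s : 'I_m -> rel nat) (i : 'I_m) (u v : nat) :
    1 < m -> u < 10 -> v < 10 ->
  layered_rel r s (mvert i u) (mvert i v) = r i u v.
Proof.
move=> m1 u10 v10; rewrite /layered_rel /= !inordK // eqxx.
by rewrite eq_sym (negPf (ordS_neq _ _)) // !orbF.
Qed.

Lemma layered_next (m : nat) (r s : 'I_m -> rel nat) (i : 'I_m) (u v : nat) :
    2 < m -> u < 10 -> v < 10 ->
  layered_rel r s (mvert i u) (mvert (ordS i) v) = s i u v.
Proof.
move=> m2 u10 v10; rewrite /layered_rel /= !inordK // eqxx.
rewrite ![i == _]eq_sym (negPf (ordS_neq _ _)) ?(negPf (ordSS_neq _ _)) //.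
  by rewrite orbF.
lia.
Qed.

Lemma layered_prev (m : nat) (r s : 'I_m -> rel nat) (i : 'I_m) (u v : nat) :
    2 < m -> u < 10 -> v < 10 ->
  layered_rel r s (mvert i u) (mvert (ord_pred i) v) = s (ord_pred i) v u.
Proof.
move=> m2 u10 v10; have m1 : 1 < m by lia.
set j := ord_pred i; have -> : i = ordS j by rewrite ord_predK.
rewrite /layered_rel /= !inordK // (negPf (ordS_neq _ _)) //.
by rewrite [j == _]eq_sym (negPf (ordSS_neq _ _)) //= eqxx.
Qed.

Lemma block_type_iota (i : nat) : block_type i \in iota 0 4.
Proof.
rewrite mem_iota /= /block_type; case: ifP => [|_]; last by case: odd.
exact: ltnW.
Qed.

Lemma linked_sym (t : nat) : symmetric (linked t).
Proof. by move=> u v; apply: eq_has => p; rewrite orbC. Qed.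

Lemma linked_inner (t : nat) : subrel (linked t) inner.
Proof.
move=> u v /hasP[p].
have inner_sym : symmetric inner by move=> a b; rewrite /inner orbC.
have chk : all (fun t => all (fun p => all (fun e => inner e.1 e.2)
  (zip p (behead p))) (block_paths t)) (iota 0 4) by vm_compute.
have [t4|t4] := ltnP t 4; last by rewrite /block_paths nth_default.
have /(allP chk)/allP chk_t : t \in iota 0 4 by rewrite mem_iota.
move=> /chk_t/allP chk_p /orP[] /chk_p //=.
by rewrite inner_sym.
Qed.

Lemma block_exits_outer (t : nat) (e : nat * nat) :
  e \in block_exits t -> outer e.1 e.2.
Proof.
have [t4|t4] := ltnP t 4; last by rewrite /block_exits nth_default.
have chk : all (fun t => all (fun e => outer e.1 e.2) (block_exits t)) (iota 0 4).
  by vm_compute.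
have /(allP chk)/allP chk_t : t \in iota 0 4 by rewrite mem_iota.
exact: chk_t.
Qed.

Lemma block_type_transition (k : nat) (i : 'I_(2 * k).+1) : 0 < k ->
  (block_type i, block_type (ordS i)) \in transitions.
Proof.
move=> k0; case: i => i /= ik; have [im|im] := ltnP i (2 * k).
  rewrite modn_small; last by lia.
  case: i ik im => [|[|[|i]]] // _ _; rewrite /block_type /=.
  by case: (odd i).
have -> : i = 2 * k by lia.
rewrite modnn; case: k k0 {ik im} => [|[|k]] // _.
have -> : 2 * k.+2 = k.*2.+4 by lia.
by rewrite /block_type /= odd_double.
Qed.

(** The degree of a vertex depends only on the types of its block and of the preceding one, so
    checking the five transitions suffices. *)
Lemma sparse_factor_two_factor (k : nat) : 0 < k ->
  two_factor (@model_adj (2 * k).+1) (@sparse_factor (2 * k).+1).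
Proof.
move=> k0; have m2 : 2 < (2 * k).+1 by lia.
have sub : subrel (@sparse_factor (2 * k).+1) (@model_adj (2 * k).+1).
  apply: layered_rel_sub => i u v; first exact: linked_inner.
  exact: block_exits_outer.
split=> // [|x]; first by apply: layered_rel_sym => i; apply: linked_sym.
rewrite -(mvertK x) card_model_nbs //; set i := x.2; set u := nat_of_ord x.1.
have u10 : u < 10 by apply: ltn_ord.
have lt10 (p : pred nat) v : v \in [seq v <- iota 0 10 | p v] -> v < 10.
  by rewrite mem_filter mem_iota => /and3P[].
pose t := block_type i; pose t' := block_type (ord_pred i).
transitivity (count (linked t u) (inner_nbs u) +
  count (fun v => (u, v) \in block_exits t) (next_nbs u) +
  count (fun v => (v, u) \in block_exits t') (prev_nbs u)).
  congr (_ + _ + _); apply: eq_in_count => v /lt10 v10.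
  - by rewrite [LHS]layered_same //; lia.
  - by rewrite [LHS]layered_next.
  - by rewrite [LHS]layered_prev.
have chk : all (fun tt => all (fun u =>
    count (linked tt.2 u) (inner_nbs u) +
    count (fun v => (u, v) \in block_exits tt.2) (next_nbs u) +
    count (fun v => (v, u) \in block_exits tt.1) (prev_nbs u) == 2)
  (iota 0 10)) transitions by vm_compute.
have /(allP chk)/allP chk_t : (t', t) \in transitions.
  by have := block_type_transition (ord_pred i) k0; rewrite ord_predK.
by apply/eqP/chk_t; rewrite mem_iota.
Qed.

Lemma joined_connect (m : nat) (i : 'I_m) (u v : nat) : 1 < m ->
  joined (block_type i) u v -> connect (@sparse_factor m) (mvert i u) (mvert i v).
Proof.
move=> m1 /hasP[p pt /andP[up vp]]; set f := @sparse_factor m.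
have f_csym : connect_sym f.
  by apply/sym_connect_sym/layered_rel_sym => j; apply: linked_sym.
have chk : all (fun t => all (fun p => sorted (linked t) p && all (ltn^~ 10) p)
  (block_paths t)) (iota 0 4) by vm_compute.
have /andP[p_sorted p10] := allP (allP chk _ (block_type_iota i)) p pt.
case: p => [//|x p] in pt up vp p_sorted p10.
have f_p : path f (mvert i x) (map (mvert i) p).
  rewrite path_map; apply: (sub_in_path (P := ltn^~ 10)) p_sorted => //.
  by move=> a b a10 b10 /= ab; rewrite /f /sparse_factor layered_same.
have to w : w \in x :: p -> connect f (mvert i x) (mvert i w).
  move=> wp; apply: (path_connect f_p); rewrite -map_cons; exact: map_f.
by rewrite (connect_trans _ (to v vp)) // f_csym to.
Qed.

Lemma connect_w (k : nat) (i : 'I_(2 * k).+1) : 0 < k ->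
  connect (@sparse_factor (2 * k).+1) (mvert i 0) (mvert ord0 0).
Proof.
move=> k0; set f := @sparse_factor _; have m2 : 2 < (2 * k).+1 by lia.
have f_csym : connect_sym f.
  by apply/sym_connect_sym/layered_rel_sym => j; apply: linked_sym.
have m1 : 1 < (2 * k).+1 by lia.
have step j : connect f (mvert j 0) (mvert (ordS j) 0).
  (* The next [w] is reached either directly or along the path from 0 to 7, the exit (7, 3) and the
     path from 3 to 0. *)
  have chk : all (fun tt => ((0, 0) \in block_exits tt.1) ||
    [&& joined tt.1 0 7, (7, 3) \in block_exits tt.1 & joined tt.2 3 0])
    transitions by vm_compute.
  case/orP: (allP chk _ (block_type_transition j k0)) => [e|/and3P[j1 e j2]].
    by apply: connect1; rewrite /f /sparse_factor layered_next.
  apply: connect_trans (joined_connect m1 j1) _.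
  apply: connect_trans (joined_connect m1 j2).
  by apply: connect1; rewrite /f /sparse_factor layered_next.
case: i => i; elim: i => [|i IHi] im.
  by rewrite (_ : Ordinal im = ord0) //; apply: val_inj.
have im' : i < (2 * k).+1 by lia.
apply: connect_trans (IHi im'); rewrite f_csym.
suff -> : Ordinal im = ordS (Ordinal im') by apply: step.
by apply: val_inj; rewrite /= modn_small.
Qed.

Lemma odd_cycles_sparse_factor (k : nat) : 0 < k ->
  odd_cycles (@sparse_factor (2 * k).+1) <= k.+2.
Proof.
move=> k0; set f := @sparse_factor _; have m2 : 2 < (2 * k).+1 by lia.
have m1 : 1 < (2 * k).+1 by lia.
(* The blocks of type 0 are 0, 3, 5, ..., 2k - 1, each with a 5-cycle through its vertex 3. The
   other two representatives stand for the long cycle and the 13-cycle. *)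
pose yb j : 'I_(2 * k).+1 := inord (if j is 0 then 0 else (2 * j).+1).
pose reps := [:: mvert ord0 0, mvert (inord 2) 3 &
  [seq mvert (yb j) 3 | j <- iota 0 k]].
have -> : k.+2 = size reps by rewrite /= size_map size_iota.
apply: odd_cycles_le => [|x].
  by apply: layered_rel_sym => j; apply: linked_sym.
rewrite -(mvertK x); set i := x.2; set u := nat_of_ord x.1.
(* Within its block, each vertex shares a path with [w], with 3 (types 0 and 2) or with 7 (type 1);
   in the last case the exit (7, 3) leads to vertex 3 of block 2. *)
have chk : all (fun t => all (fun u =>
    [|| joined t u 0, ((t == 0) || (t == 2)) && joined t u 3
    | (t == 1) && joined t u 7]) (iota 0 10)) (iota 0 4) by vm_compute.
have u10 : u \in iota 0 10 by rewrite mem_iota ltn_ord.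
have type2 (j : 'I_(2 * k).+1) : block_type j = 2 -> j = inord 2.
  rewrite /block_type; case: ltnP => [_ j2|_]; last by case: odd.
  by apply: val_inj; rewrite /= inordK.
case/or3P: (allP (allP chk _ (block_type_iota i)) _ u10) => [j0|/andP[/orP[]/eqP ti j3]|].
- exists (mvert ord0 0); first by rewrite mem_head.
  exact: connect_trans (joined_connect m1 j0) (connect_w _ k0).
- exists (mvert i 3); last exact: joined_connect.
  suff [j jk ->] : exists2 j, j < k & i = yb j.
    by rewrite !in_cons (map_f (fun j => mvert (yb j) 3)) ?orbT // mem_iota.
  move: ti; rewrite /block_type; case: ltnP => [_ i0|i3].
    by exists 0 => //; apply: val_inj; rewrite /= inordK.
  case: ifP => // oi _; have := ltn_ord i; have := odd_double_half i.
  rewrite oi => hi ik; exists i./2; first by lia.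
  apply: val_inj; rewrite /= inordK; case: (i./2) hi => [|j]; lia.
- exists (mvert i 3); last exact: joined_connect.
  by rewrite (type2 i ti) !inE eqxx orbT.
case/andP=> /eqP ti j7; exists (mvert (ordS i) 3).
  rewrite (type2 (ordS i)) ?inE ?eqxx ?orbT //.
  have := block_type_transition i k0.
  by rewrite ti; case: (block_type _) => [|[|[|]]].
apply: connect_trans (joined_connect m1 j7) _.
by apply: connect1; rewrite /f /sparse_factor layered_next // ti.
Qed.

Lemma model_oddness (k : nat) : 0 < k ->
  is_oddness (@model_adj (2 * k).+1) (if odd k then k + 1 else k + 2).
Proof.
move=> k0; have m2 : 2 < (2 * k).+1 by lia.
have oddm : odd #|model (2 * k).+1| = false by rewrite card_prod !card_ord oddM.
have ge f : two_factor (@model_adj (2 * k).+1) f ->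
    (if odd k then k + 1 else k + 2) <= odd_cycles f.
  move=> f_e; have := odd_cycles_model_ge m2 f_e; have [f_sym _ _] := f_e.
  have := odd_odd_cycles f_sym; rewrite oddm; case: ifP; lia.
split=> //; have f_e := sparse_factor_two_factor k0.
exists (@sparse_factor (2 * k).+1) => //.
have := ge _ f_e; have := odd_cycles_sparse_factor k0; have [f_sym _ _] := f_e.
have := odd_odd_cycles f_sym; rewrite oddm; case: ifP; lia.
Qed.

(** * The isomorphism with the model *)

(* Coordinates on the Petersen graph minus [o]: a 6-cycle through the [x i] and
   [y i], where [n i] is joined to the two antipodal vertices [x i] and [y i]. *)
Record coordinates (o : petersen) (n x y : 'I_3 -> petersen_minus o) : Prop :=
  Coordinates {
    adj_nn : forall i j, petersen_adj (sval (n i)) (sval (n j)) = false;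
    adj_nx : forall i j, petersen_adj (sval (n i)) (sval (x j)) = (i == j);
    adj_ny : forall i j, petersen_adj (sval (n i)) (sval (y j)) = (i == j);
    adj_xx : forall i j, petersen_adj (sval (x i)) (sval (x j)) = false;
    adj_yy : forall i j, petersen_adj (sval (y i)) (sval (y j)) = false;
    adj_xy : forall i j, petersen_adj (sval (x i)) (sval (y j)) = (i != j) }.

Lemma petersen_adj_sym : symmetric petersen_adj.
Proof. by move=> S U; apply: disjoint_sym. Qed.

(** Corresponds to exchanging the two elements of [o]: the automorphism that fixes every n_i and
    exchanges A' and B'. *)
Lemma coordinates_swap (o : petersen) (n x y : 'I_3 -> petersen_minus o) :
  coordinates n x y -> coordinates n y x.
Proof.
by case=> *; split=> // i j; rewrite petersen_adj_sym eq_sym.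
Qed.

Lemma coordinates_exist (o : petersen) (n : 'I_3 -> petersen_minus o) :
    injective n -> (forall i, petersen_adj o (sval (n i))) ->
  exists x y, coordinates n x y.
Proof.
move=> n_inj o_n.
have /cards2P[a [b [ab def_o]]] := valP o.
pose N i : {set 'I_5} := sval (sval (n i)).
have N_card i : #|N i| = 2 by apply/eqP; apply: (valP (sval (n i))).
have oN i : [disjoint sval o & N i] := o_n i.
(* Two disjoint pairs leave exactly one of the five elements. *)
have /fin_all_exists[c def_c] i : exists c, ~: (sval o :|: N i) = [set c].
  apply/cards1P; have := cardsC (sval o :|: N i).
  rewrite cardsU (disjoint_setI0 (oN i)) cards0 N_card card_ord.
  by rewrite (eqP (valP o)) => /eqP; rewrite subn0 eqn_add2l.
have memN i z : (z \in N i) = [&& z != a, z != b & z != c i].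
  have := congr1 (fun S : {set _} => z \in S) (def_c i).
  have := disjointFr (oN i) (x := z).
  rewrite def_o !inE negb_or negb_or.
  case: (z == a) => [->//|]; case: (z == b) => [->//|] /= _ <-.
  by rewrite negbK.
have c_o i : (c i != a) && (c i != b).
  have : c i \in ~: (sval o :|: N i) by rewrite def_c set11.
  by rewrite def_o !inE !negb_or => /andP[].
have c_inj : injective c.
  move=> i j cij; apply: n_inj; do 2!apply: val_inj.
  by apply/setP=> z; rewrite -!/(N _) !memN cij.
have ex d (dab : d \in [:: a; b]) i :
    exists x : petersen_minus o, sval (sval x) = [set d; c i].
  have /andP[ca cb] := c_o i.
  have dc : #|[set d; c i]| == 2.
    suff dc : d != c i by rewrite cards2 dc.
    by move: dab; rewrite !inE => /orP[] /eqP->; rewrite eq_sym.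
  pose X : petersen := exist (fun S : {set 'I_5} => #|S| == 2) _ dc.
  have Xo : X != o.
    apply/eqP=> /(congr1 sval) /= /setP/(_ (c i)).
    by rewrite def_o !inE eqxx orbT (negPf ca) (negPf cb).
  by exists (exist (fun z => z != o) X Xo).
have /fin_all_exists[x xE] := ex a (mem_head _ _).
have /fin_all_exists[y yE] := ex b (mem_last _ [:: b]).
have adjN i d j : d \in [:: a; b] -> [disjoint N i & [set d; c j]] = (i == j).
  move=> dab; rewrite disjoint_sym disjoints_subset subUset !sub1set !inE !memN.
  have /andP[-> ->] := c_o j; rewrite /= negbK (inj_eq c_inj) eq_sym.
  by move: dab; rewrite !inE => /orP[] /eqP->; rewrite eqxx ?andbF.
exists x, y; split=> i j; rewrite /petersen_adj ?xE ?yE -/(N _) ?adjN //.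
(* If [N i] and [N j] were disjoint, [N j] would avoid [o] and [N i], leaving only [c i] for its two
   elements. *)
- apply/negP=> dij.
  suff /subset_leq_card : N j \subset [set c i] by rewrite N_card cards1.
  apply/subsetP=> z zj; rewrite inE; have := disjointFl dij zj.
  by move: zj; rewrite !memN => /and3P[-> -> _] /= /negPn.
- exact: mem_head.
- exact: (mem_last a [:: b]).
- by apply/pred0Pn; exists a; rewrite /= !inE eqxx.
- by apply/pred0Pn; exists b; rewrite /= !inE eqxx.
rewrite disjoints_subset subUset !sub1set !inE !negb_or ab /= (inj_eq c_inj).
rewrite [a == _]eq_sym.
by have /andP[-> _] := c_o j; have /andP[_ ->] := c_o i.
Qed.

Lemma coordinates_neq (o : petersen) (n x y : 'I_3 -> petersen_minus o) :
    coordinates n x y ->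
  [/\ injective n, injective x, injective y, forall i j, (n i == x j) = false &
      forall i j, (n i == y j) = false /\ (x i == y j) = false].
Proof.
case=> nn nx ny xx yy xy; split=> [i j e|i j e|i j e|i j|i j].
- by apply/eqP; rewrite -(nx i j) e nx eqxx.
- by apply/eqP; rewrite -(nx i j) -e nx eqxx.
- by apply/eqP; rewrite -(ny i j) -e ny eqxx.
- by apply/eqP=> e; have := xx j i; rewrite -e nx eqxx.
split; apply/eqP=> e; first by have := yy j i; rewrite -e ny eqxx.
(* Any index other than [i] would do: x_i is adjacent to the y of that index, whereas y_j is not. *)
by have := yy j (ordS i); rewrite -e xy eq_sym ordS_neq.
Qed.

(* Names of the vertices of T-bar: [inr i] is p_i, and [inl (k, i)] is n_i, x_i or
   y_i according to whether [k] is [None], [Some false] or [Some true]. *)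
Definition code : finType := (option bool * 'I_3 + 'I_3)%type.

Definition code_vertex (o : petersen) (n x y : 'I_3 -> petersen_minus o)
    (c : code) : tbar_vertex o :=
  match c with
  | inl (None, i) => inl (n i)
  | inl (Some false, i) => inl (x i)
  | inl (Some true, i) => inl (y i)
  | inr i => inr i
  end.

Definition code_adj : rel code := fun c d =>
  match c, d with
  | inl (Some a, i), inl (Some b, j) => (a != b) && (i != j)
  | inl (None, _), inl (None, _) => false
  | inl (_, i), inl (_, j) => i == j
  | inr i, inr j => i != j
  | inl (k, i), inr j | inr j, inl (k, i) => (k == None) && (i == j)
  end.

(* The vertices 1, ..., 9 of a block of the model. *)
Definition block_codes : seq code :=
  [:: inr i3; inl (None, i3); inl (None, i1); inl (Some false, i1);
      inl (Some true, i1); inl (Some false, i2); inl (Some true, i2);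
      inl (Some false, i3); inl (Some true, i3)].

Lemma code_vertex_inj (o : petersen) (n x y : 'I_3 -> petersen_minus o) :
  coordinates n x y -> injective (code_vertex n x y).
Proof.
case/coordinates_neq=> n_inj x_inj y_inj nx nyxy.
have ny i j : (n i == y j) = false by have [] := nyxy i j.
have xy i j : (x i == y j) = false by have [] := nyxy i j.
case=> [[[[]|] i]|i] [[[[]|] j]|j] //= [].
- by move/y_inj->.
- by move/esym/eqP; rewrite xy.
- by move/esym/eqP; rewrite ny.
- by move/eqP; rewrite xy.
- by move/x_inj->.
- by move/esym/eqP; rewrite nx.
- by move/eqP; rewrite ny.
- by move/eqP; rewrite nx.
- by move/n_inj->.
- by move->.
Qed.

Lemma tbar_adj_code (o : petersen) (n x y : 'I_3 -> petersen_minus o) :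
    coordinates n x y ->
  {mono code_vertex n x y : c d / code_adj c d >-> tbar_adj n c d}.
Proof.
move=> co; have [n_inj _ _ n_x n_yxy] := coordinates_neq co.
have x_n i j : (x i == n j) = false by rewrite eq_sym n_x.
have y_n i j : (y i == n j) = false.
  by rewrite eq_sym; have [-> _] := n_yxy j i.
case: co => nn nx ny xx yy xy.
case=> [[[[]|] i]|i] [[[[]|] j]|j]; rewrite /code_vertex /tbar_adj /code_adj.
- by rewrite yy.
- by rewrite petersen_adj_sym xy eq_sym.
- by rewrite petersen_adj_sym ny eq_sym.
- by rewrite y_n.
- by rewrite xy.
- by rewrite xx.
- by rewrite petersen_adj_sym nx eq_sym.
- by rewrite x_n.
- by rewrite ny.
- by rewrite nx.
- by rewrite nn.
- by rewrite (inj_eq n_inj).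
- by rewrite y_n.
- by rewrite x_n.
- by rewrite (inj_eq n_inj).
- by [].
Qed.

(** The count is 10 - 1 + 3 - 3; it turns injectivity of [of_model] into bijectivity. *)
Lemma card_t2_vertex (o : petersen) (n : 'I_3 -> petersen_minus o) :
  #|t2_vertex n| = 9.
Proof.
have card_p : #|petersen| = 10.
  by rewrite card_sig -(eq_card (in_set _)) card_draws card_ord.
have card_pm : #|petersen_minus o| = 9.
  by rewrite card_sig -[LHS]/(#|predC1 o|) cardC1 card_p.
have card_t : #|tbar_vertex o| = 12 by rewrite card_sum card_pm card_ord.
set s := [:: tbar_p o i1; tbar_p o i2; tbar_n n i2].
have s_uniq : uniq s by [].
have := cardC (mem s); rewrite card_t (card_uniqP s_uniq) card_sig => /eqP.
by rewrite eqn_add2l => /eqP.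
Qed.

(** Index [u] stands for vertex [u + 1] of a block, since 0 is [w]; [A] supplies the default value
    that [insubd] asks for. *)
Definition t2_of_nat (o : petersen) (n x y : 'I_3 -> petersen_minus o)
    (A : t2_vertex n) (u : nat) : t2_vertex n :=
  insubd A (code_vertex n x y (nth (inr i3) block_codes u)).

Lemma sval_t2_of_nat (o : petersen) (n x y : 'I_3 -> petersen_minus o)
    (A : t2_vertex n) (u : nat) : coordinates n x y -> u < 9 ->
  sval (t2_of_nat x y A u) = code_vertex n x y (nth (inr i3) block_codes u).
Proof.
move=> co u9; apply: insubdK.
pose deleted : seq code := [:: inr i1; inr i2; inl (None, i2)].
have chk : all (fun u => nth (inr i3) block_codes u \notin deleted) (iota 0 9).
  by vm_compute.
have u_in : u \in iota 0 9 by rewrite mem_iota.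
have := allP chk u u_in; rewrite -(mem_map (code_vertex_inj co)).
by apply.
Qed.

Lemma t2_of_nat_eq (o : petersen) (n x y : 'I_3 -> petersen_minus o)
    (A : t2_vertex n) (u v : nat) : coordinates n x y -> u < 9 -> v < 9 ->
  (t2_of_nat x y A u == t2_of_nat x y A v) = (u == v).
Proof.
move=> co u9 v9; rewrite -(inj_eq val_inj) -![\val _]/(sval _).
rewrite !sval_t2_of_nat // (inj_eq (code_vertex_inj co)).
by rewrite nth_uniq // -[uniq _]/true.
Qed.

Definition of_model (o : petersen) (n x y : 'I_3 -> petersen_minus o)
    (A : t2_vertex n) (m : nat) (p : model m) : t2alpha_vertex n m :=
  if nat_of_ord p.1 is u.+1 then inl (t2_of_nat x y A u, p.2) else inr p.2.

Lemma of_model_bij (o : petersen) (n x y : 'I_3 -> petersen_minus o)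
    (A : t2_vertex n) (m : nat) :
  coordinates n x y -> bijective (@of_model o n x y A m).
Proof.
move=> co; apply: inj_card_bij; last first.
  by rewrite card_sum !card_prod card_t2_vertex !card_ord -mulSnr.
move=> [[[|u] u10] i] [[[|v] v10] j]; rewrite /of_model /=.
- by case=> ->; congr (_, _); apply: val_inj.
- by [].
- by [].
case=> /eqP; rewrite t2_of_nat_eq // => /eqP uv ->.
by congr (_, _); apply: val_inj; rewrite /= uv.
Qed.

(** Under this labeling the outer edges (6, 1) and (7, 3) are the connecting edges A'A and B'B, as
    6, 7, 1, 3 number x_2, y_2, p_3, n_1. Adjacency inside a block is a finite check on codes. *)
Lemma of_model_adj (o : petersen) (n x y : 'I_3 -> petersen_minus o)
    (A B A' B' : t2_vertex n) (m : nat) :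
    coordinates n x y -> sval A = tbar_p o i3 -> sval B = inl (n i1) ->
    sval A' = inl (x i2) -> sval B' = inl (y i2) ->
  {mono @of_model o n x y A m : p q /
    model_adj p q >-> t2alpha_adj A B A' B' p q}.
Proof.
move=> co At Bt A't B't; pose t := t2_of_nat x y A.
have tE u : u < 9 -> sval (t u) = code_vertex n x y (nth (inr i3) block_codes u).
  exact: sval_t2_of_nat.
have {}At : A = t 0 by apply: val_inj; rewrite /= At tE.
have {}Bt : B = t 2 by apply: val_inj; rewrite /= Bt tE.
have {}A't : A' = t 5 by apply: val_inj; rewrite /= A't tE.
have {}B't : B' = t 6 by apply: val_inj; rewrite /= B't tE.
have t_eq u v : u < 9 -> v < 9 -> (t u == t v) = (u == v).
  exact: t2_of_nat_eq.
have t_p3 u : u < 9 -> (sval (t u) == tbar_p o i3) = (u == 0).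
  move=> u9; rewrite -(t_eq u 0) // -(inj_eq val_inj) -![\val _]/(sval _).
  by rewrite (tE 0).
have inner0 u : u < 9 -> inner 0 u.+1 = (u == 0).
  have chk : all (fun u => inner 0 u.+1 == (u == 0)) (iota 0 9) by vm_compute.
  by move=> u9; apply/eqP/(allP chk); rewrite mem_iota.
have inner_sym u v : inner u v = inner v u by rewrite /inner orbC.
have innerS u v : u < 9 -> v < 9 -> t2_adj (t u) (t v) = inner u.+1 v.+1.
  move=> u9 v9; rewrite /t2_adj !tE // tbar_adj_code //.
  have chk : all (fun u => all (fun v => code_adj (nth (inr i3) block_codes u)
    (nth (inr i3) block_codes v) == inner u.+1 v.+1) (iota 0 9)) (iota 0 9).
    by vm_compute.
  have u_in : u \in iota 0 9 by rewrite mem_iota.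
  have v_in : v \in iota 0 9 by rewrite mem_iota.
  exact: (eqP (allP (allP chk u u_in) v v_in)).
have outerS u v :
    outer u.+1 v.+1 = (u == 5) && (v == 0) || (u == 6) && (v == 2).
  by rewrite /outer !inE !xpair_eqE !eqSS /= orbF.
have outer0 u : outer 0 u.+1 = false /\ outer u.+1 0 = false.
  by rewrite /outer !inE !xpair_eqE /= !andbF.
move=> [[[|u] u10] i] [[[|v] v10] j];
  rewrite /t2alpha_adj /t2alpha_arc /model_adj /layered_rel /of_model;
  lazy beta iota delta [fst snd nat_of_ord].
- by rewrite /= !andbT andbF.
- rewrite -/(t v) t_p3 // inner0 //; have [-> ->] := outer0 v.
  by rewrite !andbF !orbF /= andbC eq_sym.
- rewrite -/(t u) t_p3 // inner_sym inner0 //; have [-> ->] := outer0 u.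
  by rewrite !andbF !orbF andbC.
rewrite -!/(t _) At Bt A't B't !innerS // !t_eq // !outerS.
rewrite (inner_sym v.+1) (eq_sym j i).
by case: (i == j); case: (inner _ _); rewrite /= ?orbT // ?orbF.
Qed.

Lemma t2alpha_oddness (k : nat) (o : petersen) (n x y : 'I_3 -> petersen_minus o)
    (A B A' B' : t2_vertex n) :
    0 < k -> coordinates n x y -> sval A = tbar_p o i3 -> sval B = inl (n i1) ->
    sval A' = inl (x i2) -> sval B' = inl (y i2) ->
  is_oddness (@t2alpha_adj o n A B A' B' (2 * k + 1))
    (if odd k then k + 1 else k + 2).
Proof.
move=> k0 co At Bt A't B't; rewrite (addn1 (2 * k)).
apply: (is_oddness_iso (of_model_bij A _ co)) (model_oddness k0).
exact: of_model_adj.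
Qed.

Lemma t2alpha_adj_swap (o : petersen) (n : 'I_3 -> petersen_minus o)
    (A B A' B' : t2_vertex n) (m : nat) :
  @t2alpha_adj o n A B A' B' m =2 @t2alpha_adj o n B A B' A' m.
Proof.
move=> [[u i]|i] [[v j]|j]; rewrite /t2alpha_adj /t2alpha_arc //.
by rewrite ![_ && _ || _ && (_ == B)]orbC.
Qed.

Lemma t2_nbs (o : petersen) (n x y : 'I_3 -> petersen_minus o)
    (c : code) (u : t2_vertex n) : coordinates n x y ->
    tbar_adj n (code_vertex n x y c) (sval u) ->
  exists2 d, d \in [seq d <- block_codes | code_adj c d] &
    sval u = code_vertex n x y d.
Proof.
move=> co.
have [v v9 <-] : exists2 v, v < 9 & t2_of_nat x y u v = u.
  (* With a single block, surjectivity of [of_model] says that the nine codes name all vertices of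
     T^2. *)
  have [g _ gK] := @of_model_bij o n x y u 1 co.
  have := gK (inl (u, ord0)); case: (g _) => -[[//|v] v10] i.
  by rewrite /of_model /= => -[vu _]; exists v.
rewrite sval_t2_of_nat // tbar_adj_code // => cd.
exists (nth (inr i3) block_codes v) => [|//].
by rewrite mem_filter cd mem_nth.
Qed.

Theorem theorem1 (k : nat) (hk : 1 <= k)
  (o : petersen) (n : 'I_3 -> petersen_minus o)
  (n_inj : injective n) (o_adj_n : forall i, petersen_adj o (sval (n i)))
  (A B A' B' : t2_vertex n)
  (AB : A != B)
  (p1A : tbar_adj n (tbar_p o i1) (sval A))
  (p1B : tbar_adj n (tbar_p o i1) (sval B))
  (AB' : A' != B')
  (n2A' : tbar_adj n (tbar_n n i2) (sval A'))
  (n2B' : tbar_adj n (tbar_n n i2) (sval B')) :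
  is_oddness (@t2alpha_adj o n A B A' B' (2 * k + 1))
    (if odd k then k + 1 else k + 2).
Proof.
have [x [y co]] := coordinates_exist n_inj o_adj_n.
have p1_nbs (u : t2_vertex n) : tbar_adj n (tbar_p o i1) (sval u) ->
    sval u = tbar_p o i3 \/ sval u = inl (n i1).
  case/(t2_nbs (c := inr i1) co) => c.
  have -> : [seq d <- block_codes | code_adj (inr i1) d] =
    [:: inr i3; inl (None, i1)] by vm_compute.
  by rewrite !inE => /orP[] /eqP-> ->; [left | right].
have n2_nbs (u : t2_vertex n) : tbar_adj n (tbar_n n i2) (sval u) ->
    sval u = inl (x i2) \/ sval u = inl (y i2).
  case/(t2_nbs (c := inl (None, i2)) co) => c.
  have -> : [seq d <- block_codes | code_adj (inl (None, i2)) d] =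
    [:: inl (Some false, i2); inl (Some true, i2)] by vm_compute.
  by rewrite !inE => /orP[] /eqP-> ->; [left | right].
have sval_neq (u v : t2_vertex n) : u != v -> sval u <> sval v.
  by move=> /eqP uv /val_inj.
have swapped : is_oddness (@t2alpha_adj o n B A B' A' (2 * k + 1))
      (if odd k then k + 1 else k + 2) ->
    is_oddness (@t2alpha_adj o n A B A' B' (2 * k + 1))
      (if odd k then k + 1 else k + 2).
  apply: (is_oddness_iso (h := id)); first by exists id.
  by move=> u v; rewrite t2alpha_adj_swap.
have := sval_neq _ _ AB; have := sval_neq _ _ AB'.
(* Distinctness of the labels leaves four cases: [swapped] puts p_3 first in its pair, and
   [coordinates_swap] then renames its partner at n_2 as x_2 where necessary. *)
case: (n2_nbs _ n2A') (n2_nbs _ n2B') => A't [] B't; rewrite A't B't //= => _;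
  case: (p1_nbs _ p1A) (p1_nbs _ p1B) => At [] Bt; rewrite At Bt //= => _.
- exact: (t2alpha_oddness hk co).
- exact/swapped/(t2alpha_oddness hk (coordinates_swap co)).
- exact: (t2alpha_oddness hk (coordinates_swap co)).
- exact/swapped/(t2alpha_oddness hk co).
Qed.
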